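(* Let $(\mathfrak{g},[\cdot,\dots,\cdot]_{\mathfrak{g}},\alpha,\beta)$ be an $n$-BiHom-Lie algebra and let $(V,\rho,\alpha_V,\beta_V)$ be a representation of it with $\alpha_V\circ\beta_V=\beta_V\circ\alpha_V$. Assume that the maps $\alpha$ and $\beta_V$ are bijective. Define $\alpha+\alpha_V,\ \beta+\beta_V:\mathfrak{g}\oplus V\to\mathfrak{g}\oplus V$ by $(\alpha+\alpha_V)(x+u)=\alpha(x)+\alpha_V(u)$ and $(\beta+\beta_V)(x+u)=\beta(x)+\beta_V(u)$, and define an $n$-linear bracket on $\mathfrak{g}\oplus V$ by $$[x_1+u_1,\dots,x_n+u_n]_{\rho}=[x_1,\dots,x_n]_{\mathfrak{g}}+\sum_{i=1}^{n-1}(-1)^{n-i}\rho(x_1,\dots,\widehat{x_i},\dots,x_{n-1},\alpha^{-1}\beta(x_n))(\alpha_V\beta_V^{-1}(u_i))+\rho(x_1,\dots,x_{n-1})(u_n)$$ for all $x_i\in\mathfrak{g}$, $u_i\in V$. Then $(\mathfrak{g}\oplus V,[\cdot,\dots,\cdot]_\rho,\alpha+\alpha_V,\beta+\beta_V)$ is an $n$-BiHom-Lie algebra.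
   Context: $\mathbb{K}$ is an algebraically closed field of characteristic $0$, all vector spaces are over $\mathbb{K}$, $n\ge 2$, and a hat denotes omission of an entry. An $n$-BiHom-Lie algebra $(\mathfrak{g},[\cdot,\dots,\cdot]_{\mathfrak{g}},\alpha,\beta)$ is a vector space $\mathfrak{g}$ with an $n$-linear operation $[\cdot,\dots,\cdot]_{\mathfrak{g}}:\mathfrak{g}^n\to\mathfrak{g}$ and linear maps $\alpha,\beta:\mathfrak{g}\to\mathfrak{g}$ such that for all elements of $\mathfrak g$: (1) $\alpha\circ\beta=\beta\circ\alpha$; (2) $\alpha([x_1,\dots,x_n]_{\mathfrak{g}})=[\alpha(x_1),\dots,\alpha(x_n)]_{\mathfrak{g}}$ and $\beta([x_1,\dots,x_n]_{\mathfrak{g}})=[\beta(x_1),\dots,\beta(x_n)]_{\mathfrak{g}}$; (3) (BiHom-skewsymmetry) $[\beta(x_1),\dots,\beta(x_{n-1}),\alpha(x_n)]_{\mathfrak{g}}$ changes sign when $x_k$ and $x_{k+1}$ are exchanged ($1\le k\le n-2$), and $[\beta(x_1),\dots,\beta(x_{n-1}),\alpha(x_n)]_{\mathfrak{g}}=-[\beta(x_1),\dots,\beta(x_{n-2}),\beta(x_n),\alpha(x_{n-1})]_{\mathfrak{g}}$; (4) ($n$-BiHom-Jacobi identity) $[\beta^2(x_1),\dots,\beta^2(x_{n-1}),[\beta(y_1),\dots,\beta(y_{n-1}),\alpha(y_n)]_{\mathfrak{g}}]_{\mathfrak{g}}=\sum_{k=1}^n(-1)^{n-k}[\beta^2(y_1),\dots,\widehat{\beta^2(y_k)},\dots,\beta^2(y_n),[\beta(x_1),\dots,\beta(x_{n-1}),\alpha(y_k)]_{\mathfrak{g}}]_{\mathfrak{g}}$.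 For $X=x_1\wedge\dots\wedge x_{n-1}\in\wedge^{n-1}\mathfrak{g}$ and a linear map $\gamma$ on $\mathfrak{g}$, put $\widetilde{\gamma}(X)=\gamma(x_1)\wedge\dots\wedge\gamma(x_{n-1})$. A representation $(V,\rho,\alpha_V,\beta_V)$ of $(\mathfrak{g},[\cdot,\dots,\cdot]_{\mathfrak{g}},\alpha,\beta)$ consists of a vector space $V$, endomorphisms $\alpha_V,\beta_V\in\mathrm{End}(V)$ and a linear map $\rho:\wedge^{n-1}\mathfrak{g}\to\mathrm{End}(V)$ (written $\rho(X)=\rho(x_1,\dots,x_{n-1})$) such that for all $X=x_1\wedge\dots\wedge x_{n-1}$, $Y=y_1\wedge\dots\wedge y_{n-1}$: (i) $\rho(\widetilde{\alpha}(X))\circ\alpha_V=\alpha_V\circ\rho(X)$; (ii) $\rho(\widetilde{\beta}(X))\circ\beta_V=\beta_V\circ\rho(X)$; (iii) $\rho(\widetilde{\alpha\beta}(X))\circ\rho(Y)-\rho(\widetilde{\beta}(Y))\circ\rho(\widetilde{\alpha}(X))=\sum_{i=1}^{n-1}\rho(\beta(y_1),\dots,\beta(y_{i-1}),[\beta(x_1),\dots,\beta(x_{n-1}),y_i]_{\mathfrak{g}},\beta(y_{i+1}),\dots,\beta(y_{n-1}))\circ\beta_V$; (iv) $\rho(\beta(y_2),\dots,\beta(y_{n-1}),[\beta(x_1),\dots,\beta(x_{n-1}),y_1]_{\mathfrak{g}})\circ\beta_V=\sum_{i=1}^{n-1}(-1)^{n-i}\rho(\alpha\beta(x_1),\dots,\widehat{\alpha\beta(x_i)},\dots,\alpha\beta(x_{n-1}),\beta(y_1))\circ\rho(y_2,\dots,y_{n-1},\alpha(x_i))+\rho(\widetilde{\alpha\beta}(X))\circ\rho(y_2,\dots,y_{n-1},y_1)$.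 *)

(* Defs.v *)
From HB Require Import structures.
From mathcomp Require Import freeg.
From mathcomp Require Import all_boot all_order all_algebra perm.
From mathcomp Require Import generic_quotient ring_quotient boolp.

Set Implicit Arguments.
Unset Strict Implicit.
Unset Printing Implicit Defensive.

Import GRing.Theory.
Local Open Scope ring_scope.

(* A list (x_1, ..., x_k) of elements of T is a finite function               *)
(* x : {ffun 'I_k -> T}; indices start at 0, so x_i is x at i - 1.            *)

Section Families.
Variables (T T' : Type).

Definition fmap k (f : T -> T') (x : {ffun 'I_k -> T}) : {ffun 'I_k -> T'} :=
  [ffun i => f (x i)].

Definition upd k (x : {ffun 'I_k -> T}) (i : 'I_k) (u : T) :
  {ffun 'I_k -> T} := [ffun j => if j == i then u else x j].

(* (x_1, ..., x_k, u) *)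
Definition snoc k (x : {ffun 'I_k -> T}) (u : T) : {ffun 'I_k.+1 -> T} :=
  [ffun i => if unlift ord_max i is Some j then x j else u].

(* (x_1, ..., \hat{x_i}, ..., x_(k+1)) *)
Definition omit k (i : 'I_k.+1) (x : {ffun 'I_k.+1 -> T}) : {ffun 'I_k -> T} :=
  [ffun j => x (lift i j)].

(* (x_1, ..., x_k), from (x_1, ..., x_(k+1)) *)
Definition front k (x : {ffun 'I_k.+1 -> T}) : {ffun 'I_k -> T} :=
  omit ord_max x.

Definition swap k (i j : 'I_k) (x : {ffun 'I_k -> T}) : {ffun 'I_k -> T} :=
  [ffun l => x (tperm i j l)].

End Families.

Section Multilinear.
Variables (K : fieldType) (k : nat) (U W : lmodType K).

Definition multilinear (f : {ffun 'I_k -> U} -> W) :=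
  forall (x : {ffun 'I_k -> U}) (i : 'I_k) (a : K) (u v : U),
    f (upd x i (a *: u + v)) = a *: f (upd x i u) + f (upd x i v).

Definition alternating (f : {ffun 'I_k -> U} -> W) :=
  forall (x : {ffun 'I_k -> U}) (i j : 'I_k), i != j -> x i = x j -> f x = 0.

End Multilinear.

(* The exterior power \wedge^k U: the quotient of the free K-vector space on  *)
(* U^k by the subspace spanned by the multilinearity and alternation          *)
(* relations.                                                                 *)

Section ExteriorPower.
Variables (K : fieldType) (k : nat) (U : lmodType K).

Local Notation free := {freeg {ffun 'I_k -> U} / K}.
Local Notation gen x := (<< x >> : free).

Inductive wedge_rel : free -> Prop :=
| WedgeRel0 : wedge_rel 0
| WedgeRelZD a p q : wedge_rel p -> wedge_rel q -> wedge_rel (a *: p + q)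
| WedgeRelLin (x : {ffun 'I_k -> U}) i a u v :
    wedge_rel (gen (upd x i (a *: u + v))
               - (a *: gen (upd x i u) + gen (upd x i v)))
| WedgeRelAlt (x : {ffun 'I_k -> U}) i j : i != j -> x i = x j -> wedge_rel (gen x).

Definition wedge_relb : {pred free} := fun p => `[< wedge_rel p >].

Fact wedge_rel_zmod_closed : zmod_closed wedge_relb.
Proof.
split=> [|p q /asboolP pR /asboolP qR]; apply/asboolP.
  exact: WedgeRel0.
by rewrite addrC -scaleN1r; apply: WedgeRelZD.
Qed.

HB.instance Definition _ :=
  GRing.isZmodClosed.Build free wedge_relb wedge_rel_zmod_closed.

Definition exterior : Type := Quotient.quot wedge_relb.

HB.instance Definition _ := GRing.Zmodule.on exterior.

Definition exterior_pi (p : free) : exterior :=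
  (\pi_(Quotient.quot wedge_relb) p)%qT.
Definition exterior_repr (X : exterior) : free :=
  repr (X : Quotient.quot wedge_relb).

Fact exterior_reprK X : exterior_pi (exterior_repr X) = X.
Proof. exact: reprK. Qed.

Fact exterior_piP p q : wedge_rel (p - q) <-> exterior_pi p = exterior_pi q.
Proof.
by split=> [pqR|/eqP]; [apply/eqP|];
  rewrite /exterior_pi -Quotient.idealrBE => *; apply/asboolP.
Qed.

Fact exterior_piD p q :
  exterior_pi (p + q) = exterior_pi p + exterior_pi q.
Proof. exact: raddfD. Qed.

Definition exterior_scale (a : K) (X : exterior) : exterior :=
  exterior_pi (a *: exterior_repr X).

Fact exterior_piZ a p : exterior_pi (a *: p) = exterior_scale a (exterior_pi p).
Proof.
apply/exterior_piP; rewrite -scalerBr -[_ *: _]addr0; apply: WedgeRelZD.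
  by apply/exterior_piP; rewrite exterior_reprK.
exact: WedgeRel0.
Qed.

Fact exterior_scaleA a b X :
  exterior_scale a (exterior_scale b X) = exterior_scale (a * b) X.
Proof. by rewrite -[X]exterior_reprK -!exterior_piZ scalerA. Qed.

Fact exterior_scale1 : left_id 1 exterior_scale.
Proof. by move=> X; rewrite -[X]exterior_reprK -!exterior_piZ scale1r. Qed.

Fact exterior_scaleDr : right_distributive exterior_scale +%R.
Proof.
move=> a X Y; rewrite -[X]exterior_reprK -[Y]exterior_reprK.
by rewrite -exterior_piD -!exterior_piZ -exterior_piD scalerDr.
Qed.

Fact exterior_scaleDl X :
  {morph exterior_scale^~ X : a b / a + b}.
Proof.
move=> a b; rewrite -[X]exterior_reprK.
by rewrite -!exterior_piZ -!exterior_piD scalerDl.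
Qed.

HB.instance Definition _ := GRing.Zmodule_isLmodule.Build K exterior
  exterior_scaleA exterior_scale1 exterior_scaleDr exterior_scaleDl.

Fact exterior_pi_linear : linear exterior_pi.
Proof. by move=> a p q; rewrite exterior_piD exterior_piZ. Qed.

HB.instance Definition _ :=
  GRing.isLinear.Build K free exterior *:%R exterior_pi exterior_pi_linear.

(* x_1 \wedge ... \wedge x_k *)
Definition wedge (x : {ffun 'I_k -> U}) : exterior := exterior_pi (gen x).

Lemma wedge_multilinear : multilinear wedge.
Proof.
move=> x i a u v; rewrite /wedge -linearP.
by apply/exterior_piP; apply: WedgeRelLin.
Qed.

Lemma wedge_alternating : alternating wedge.
Proof.
move=> x i j ij xij; rewrite /wedge -(linear0 exterior_pi).
by apply/exterior_piP; rewrite subr0; apply: WedgeRelAlt xij.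
Qed.

Fact exterior_piE p : exterior_pi p = \sum_(x <- dom p) coeff x p *: wedge x.
Proof.
rewrite -{1}[p]freeg_sumE linear_sum; apply: eq_bigr => x _.
rewrite /wedge -linearZ /=.
congr exterior_pi; apply/eqP/freeg_eqP => y.
by rewrite coeffZ !coeffU mul1r.
Qed.

Section Universal.
Variables (W : lmodType K) (f : {ffun 'I_k -> U} -> W).
Hypotheses (f_lin : multilinear f) (f_alt : alternating f).

Let F : free -> W := fglift f.

Let FD p q : F (p - q) = F p - F q.
Proof. exact: lift_is_additive. Qed.

Let F_additive : zmod_morphism F := FD.
HB.instance Definition _ := GRing.isZmodMorphism.Build free W F F_additive.

Let FZ a p : F (a *: p) = a *: F p.
Proof.
have Fsum q : F q = \sum_(x <- dom q) coeff x q *: f x.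
  rewrite -{1}[q]freeg_sumE raddf_sum; apply: eq_bigr => x _.
  by rewrite /= /F liftU.
rewrite (Fsum p) scaler_sumr -[_ *: p]/(fgscale a p) /fgscale raddf_sum.
by apply: eq_bigr => x _; rewrite /= /F liftU scalerA.
Qed.

Let F_rel p : wedge_rel p -> F p = 0.
Proof.
elim=> [|a q r _ q0 _ r0|x i a u v|x i j ij xij].
- exact: raddf0.
- by rewrite raddfD /= FZ q0 r0 scaler0 addr0.
- rewrite raddfB raddfD /= FZ /F !liftU !scale1r; apply/eqP.
  by rewrite subr_eq0; apply/eqP/f_lin.
- by rewrite /F liftU scale1r; apply: f_alt xij.
Qed.

Let h (X : exterior) : W := F (exterior_repr X).

Let h_pi p : h (exterior_pi p) = F p.
Proof.
apply/eqP; rewrite -subr_eq0 -raddfB; apply/eqP/F_rel/exterior_piP.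
exact: exterior_reprK.
Qed.

Let h_linear : linear h.
Proof.
move=> a X Y; rewrite -[X]exterior_reprK -[Y]exterior_reprK.
by rewrite [_ *: _](esym (exterior_piZ _ _)) -exterior_piD !h_pi raddfD /= FZ.
Qed.
HB.instance Definition _ :=
  GRing.isLinear.Build K exterior W *:%R h h_linear.

Lemma exterior_universal :
  exists2 h : {linear exterior -> W}, (forall x, h (wedge x) = f x)
    & forall h' : {linear exterior -> W},
        (forall x, h' (wedge x) = f x) -> h' =1 h.
Proof.
have hE x : h (wedge x) = f x by rewrite h_pi /F liftU scale1r.
exists h => // h' h'E X; rewrite -[X]exterior_reprK exterior_piE !linear_sum /=.
by apply: eq_bigr => x _; rewrite !linearZ /= h'E hE.
Qed.

End Universal.

End ExteriorPower.

Arguments exterior {K} k U.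
Arguments wedge {K k U} x.

Section NBiHomLie.
Variables (K : fieldType) (m : nat) (g : lmodType K).

(* n-BiHom-Lie algebras for n = m + 2, so that n ranges over all n >= 2       *)
Record is_nBiHomLie (br : {ffun 'I_m.+2 -> g} -> g)
    (alpha beta : {linear g -> g}) : Prop := {
  br_multilinear : multilinear br;
  alpha_beta_comm : forall x, alpha (beta x) = beta (alpha x);
  alpha_br : forall x, alpha (br x) = br (fmap alpha x);
  beta_br : forall x, beta (br x) = br (fmap beta x);
  br_skew_front : forall (x : {ffun 'I_m.+1 -> g}) (z : g) (i j : 'I_m.+1),
    j = i.+1 :> nat ->
    br (snoc (fmap beta (swap i j x)) (alpha z))
    = - br (snoc (fmap beta x) (alpha z));
  br_skew_last : forall (x : {ffun 'I_m -> g}) (y z : g),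
    br (snoc (snoc (fmap beta x) (beta y)) (alpha z))
    = - br (snoc (snoc (fmap beta x) (beta z)) (alpha y));
  (* k : 'I_n is the 1-based index k + 1, whence the exponent n - (k + 1)     *)
  br_jacobi : forall (x : {ffun 'I_m.+1 -> g}) (y : {ffun 'I_m.+2 -> g}),
    br (snoc (fmap (beta \o beta) x)
             (br (snoc (fmap beta (front y)) (alpha (y ord_max)))))
    = \sum_(k < m.+2) (-1) ^+ (m.+2 - k.+1) *:
        br (snoc (fmap (beta \o beta) (omit k y))
                 (br (snoc (fmap beta x) (alpha (y k)))))
}.

Variables (br : {ffun 'I_m.+2 -> g} -> g) (alpha beta : {linear g -> g}).
Variable V : lmodType K.

Record is_representation (rho : exterior m.+1 g -> {linear V -> V})
    (alphaV betaV : {linear V -> V}) : Prop := {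
  rho_linear : forall (a : K) (X Y : exterior m.+1 g) (v : V),
    rho (a *: X + Y) v = a *: rho X v + rho Y v;
  rho_alpha : forall (x : {ffun 'I_m.+1 -> g}) (v : V),
    rho (wedge (fmap alpha x)) (alphaV v) = alphaV (rho (wedge x) v);
  rho_beta : forall (x : {ffun 'I_m.+1 -> g}) (v : V),
    rho (wedge (fmap beta x)) (betaV v) = betaV (rho (wedge x) v);
  rho_comm : forall (x y : {ffun 'I_m.+1 -> g}) (v : V),
    rho (wedge (fmap (alpha \o beta) x)) (rho (wedge y) v)
      - rho (wedge (fmap beta y)) (rho (wedge (fmap alpha x)) v)
    = \sum_(i < m.+1)
        rho (wedge (upd (fmap beta y) i (br (snoc (fmap beta x) (y i)))))
            (betaV v);
  (* y is (y_2, ..., y_(n-1)) and z is y_1                                    *)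
  rho_br : forall (x : {ffun 'I_m.+1 -> g}) (z : g) (y : {ffun 'I_m -> g})
      (v : V),
    rho (wedge (snoc (fmap beta y) (br (snoc (fmap beta x) z)))) (betaV v)
    = \sum_(i < m.+1) (-1) ^+ (m.+2 - i.+1) *:
        rho (wedge (snoc (fmap (alpha \o beta) (omit i x)) (beta z)))
            (rho (wedge (snoc y (alpha (x i)))) v)
      + rho (wedge (fmap (alpha \o beta) x)) (rho (wedge (snoc y z)) v)
}.

End NBiHomLie.

Section BijInverse.
Variables (T U : choiceType) (f : T -> U) (bij_f : bijective f).

Fact bij_surj (y : U) : exists x, f x == y.
Proof. by case: bij_f => h _ fK; exists (h y); rewrite fK. Qed.

Definition bij_inv (y : U) : T := xchoose (bij_surj y).

Lemma bij_invK : cancel bij_inv f.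
Proof. by move=> y; apply/eqP; exact: (xchooseP (bij_surj y)). Qed.

Lemma bijK : cancel f bij_inv.
Proof. by move=> x; apply: (bij_inj bij_f); rewrite bij_invK. Qed.

End BijInverse.

Section DirectSum.
Variables (K : fieldType) (g V : lmodType K).

Definition dsum_map (f : g -> g) (h : V -> V) (z : g * V) : g * V :=
  (f z.1, h z.2).

Variables (f : {linear g -> g}) (h : {linear V -> V}).

Fact dsum_map_linear : linear (dsum_map f h).
Proof. by move=> a z w; rewrite /dsum_map /= !linearP. Qed.

HB.instance Definition _ :=
  GRing.isLinear.Build K (g * V)%type (g * V)%type *:%R (dsum_map f h)
    dsum_map_linear.

End DirectSum.

Section SemidirectBracket.
Variables (K : fieldType) (m : nat) (g V : lmodType K).
Variables (br : {ffun 'I_m.+2 -> g} -> g) (alpha beta : {linear g -> g}).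
Variables (rho : exterior m.+1 g -> {linear V -> V}).
Variables (alphaV betaV : {linear V -> V}).
Variables (bij_alpha : bijective alpha) (bij_betaV : bijective betaV).

Definition br_rho (z : {ffun 'I_m.+2 -> g * V}) : g * V :=
  let x := fmap fst z in
  let u := fmap snd z in
  (br x,
   \sum_(i < m.+1) (-1) ^+ (m.+2 - i.+1) *:
     rho (wedge (snoc (omit i (front x))
                      (bij_inv bij_alpha (beta (x ord_max)))))
         (alphaV (bij_inv bij_betaV (front u i)))
   + rho (wedge (front x)) (u ord_max)).

End SemidirectBracket.

(* Main.v *)
(* On arguments of the form [beta z_1, ..., beta z_(n-1), alpha z_n] the      *)
(* twists by alpha^-1 beta and alphaV betaV^-1 cancel, so the V-component     *)
(* becomes sum_k (-1)^(n-k) rho(beta(x without x_k))(alphaV u_k), which       *)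
(* is visibly skew under every permutation of the z_k. In the Jacobi identity *)
(* for z = x + u and w = y + v, the coefficients of each u_i agree by axiom   *)
(* (iv) of a representation at X = alpha^-1 beta (y_1, ..., y_(n-1)); those   *)
(* of each v_l agree by axiom (iii) at X = alpha^-1 beta x and                *)
(* Y = beta (y without y_l), once the replaced entry of each wedge has been   *)
(* moved to the last position.                                                *)

Require Import Defs.
From mathcomp Require Import all_boot all_order all_algebra.
From mathcomp Require Import perm zify.

Set Implicit Arguments.
Unset Strict Implicit.
Unset Printing Implicit Defensive.

Import GRing.Theory.
Local Open Scope ring_scope.

(** Axioms (3) and (4) evaluate the bracket only on twisted arguments. There [bracket_twisted] turns
    its V-component into [twisted_action], in which the last slot is no longer special. Permuting
    the slots then costs the sign of the permutation ([twisted_action_perm]), which gives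
    skewsymmetry. In the Jacobi identity the g-component is the identity of g, and the V-component
    is linear in the [u i] and the [v k]. [rho_br_twisted] settles the [u i]. [rho_comm_twisted]
    exchanges the two actions on [v k] at the cost of a correction sum; these corrections run over
    ordered pairs of positions omitted from y and match the other side after the pair is flipped
    ([exchange_pairs]). Bijectivity of alpha supplies X with alpha X = beta x, so that the alpha
    beta X of the axioms becomes beta^2 x. *)

Section FamilyTheory.
Variables (T : Type).

(** * Permuting, omitting and replacing entries of families *)

Definition permute k (s : {perm 'I_k}) (x : {ffun 'I_k -> T}) :
  {ffun 'I_k -> T} := [ffun i => x (s i)].

Lemma permute1 k (x : {ffun 'I_k -> T}) : permute 1 x = x.
Proof. by apply/ffunP=> i; rewrite ffunE perm1. Qed.

Lemma permuteM k (s t : {perm 'I_k}) (x : {ffun 'I_k -> T}) :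
  permute (s * t)%g x = permute s (permute t x).
Proof. by apply/ffunP=> i; rewrite !ffunE permM. Qed.

Lemma swapE k (i j : 'I_k) (x : {ffun 'I_k -> T}) :
  swap i j x = permute (tperm i j) x.
Proof. by []. Qed.

Lemma upd_id k (x : {ffun 'I_k -> T}) i : upd x i (x i) = x.
Proof. by apply/ffunP=> j; rewrite ffunE; case: eqP => [->|]. Qed.

Lemma updC k (x : {ffun 'I_k -> T}) i j u v :
  i != j -> upd (upd x i u) j v = upd (upd x j v) i u.
Proof.
move=> ij; apply/ffunP=> l; rewrite !ffunE.
by case: (eqVneq l j) => [->|//]; rewrite eq_sym (negPf ij).
Qed.

Lemma snoc_max k (x : {ffun 'I_k -> T}) u : snoc x u ord_max = u.
Proof. by rewrite ffunE unlift_none. Qed.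

Lemma snoc_lift k (x : {ffun 'I_k -> T}) u i : snoc x u (lift ord_max i) = x i.
Proof. by rewrite ffunE liftK. Qed.

Lemma snoc_ext k (x y : {ffun 'I_k.+1 -> T}) :
  x ord_max = y ord_max -> front x = front y -> x = y.
Proof.
move=> xy_max /ffunP xy; apply/ffunP=> i.
by case: (unliftP ord_max i) => [j ->|-> //]; move: (xy j); rewrite !ffunE.
Qed.

Lemma front_snoc k (x : {ffun 'I_k -> T}) u : front (snoc x u) = x.
Proof. by apply/ffunP=> i; rewrite ffunE snoc_lift. Qed.

Lemma frontK k (x : {ffun 'I_k.+1 -> T}) : snoc (front x) (x ord_max) = x.
Proof. by apply: snoc_ext; rewrite ?snoc_max ?front_snoc. Qed.

Lemma omit_snoc k (x : {ffun 'I_k.+1 -> T}) u (i : 'I_k.+1) :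
  omit (lift ord_max i) (snoc x u) = snoc (omit i x) u.
Proof.
apply: snoc_ext; rewrite ?snoc_max ?front_snoc; first rewrite ffunE.
  suff -> : lift (lift ord_max i) ord_max = ord_max by rewrite snoc_max.
  by apply: val_inj; rewrite /= /bump; have := ltn_ord i; lia.
apply/ffunP=> j; rewrite !ffunE.
suff -> : lift (lift ord_max i) (lift ord_max j) = lift ord_max (lift i j).
  by rewrite liftK.
by apply: val_inj; rewrite /= /bump; have := ltn_ord i; have := ltn_ord j; lia.
Qed.

Lemma omit_upd k (x : {ffun 'I_k.+1 -> T}) i u : omit i (upd x i u) = omit i x.
Proof. by apply/ffunP=> j; rewrite !ffunE eq_sym (negPf (neq_lift _ _)). Qed.

Lemma omit_upd_lift k (x : {ffun 'I_k.+1 -> T}) i j u :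
  omit i (upd x (lift i j) u) = upd (omit i x) j u.
Proof. by apply/ffunP=> l; rewrite !ffunE (inj_eq (@lift_inj _ i)). Qed.

Lemma snoc_upd k (x : {ffun 'I_k -> T}) i u v :
  snoc (upd x i u) v = upd (snoc x v) (lift ord_max i) u.
Proof.
apply: snoc_ext; last by rewrite /front omit_upd_lift -!/(front _) !front_snoc.
by rewrite snoc_max ffunE (negPf (neq_lift _ _)) snoc_max.
Qed.

Lemma upd_snoc_max k (x : {ffun 'I_k -> T}) u v :
  upd (snoc x v) ord_max u = snoc x u.
Proof.
apply: snoc_ext; last by rewrite /front omit_upd -!/(front _) !front_snoc.
by rewrite snoc_max ffunE eqxx.
Qed.

Lemma swap_snoc k (x : {ffun 'I_k -> T}) i j u :
  snoc (swap i j x) u = swap (lift ord_max i) (lift ord_max j) (snoc x u).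
Proof.
apply: snoc_ext.
  by rewrite snoc_max ffunE tpermD ?snoc_max // eq_sym neq_lift.
rewrite front_snoc; apply/ffunP=> l; rewrite !ffunE.
by rewrite -inj_tperm ?liftK //; apply: lift_inj.
Qed.

(* The bijection that s induces between the index sets with i, respectively   *)
(* s i, removed; the default value j is never used.                           *)
Definition omitted_index k (i : 'I_k.+1) (s : {perm 'I_k.+1}) (j : 'I_k) :=
  odflt j (unlift (s i) (s (lift i j))).

Lemma lift_omitted_index k i (s : {perm 'I_k.+1}) j :
  lift (s i) (omitted_index i s j) = s (lift i j).
Proof.
rewrite /omitted_index; case: unliftP => [l -> //|/perm_inj/eqP].
by rewrite eq_sym (negPf (neq_lift _ _)).
Qed.

Lemma omitted_index_inj k i (s : {perm 'I_k.+1}) :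
  injective (omitted_index i s).
Proof.
move=> j l /(congr1 (lift (s i))); rewrite !lift_omitted_index.
by move=> /perm_inj/lift_inj.
Qed.

Definition omitted_perm k i (s : {perm 'I_k.+1}) : {perm 'I_k} :=
  perm (@omitted_index_inj k i s).

Lemma omit_permute k i (s : {perm 'I_k.+1}) (x : {ffun 'I_k.+1 -> T}) :
  omit i (permute s x) = permute (omitted_perm i s) (omit (s i) x).
Proof. by apply/ffunP=> j; rewrite !ffunE permE lift_omitted_index. Qed.

(** Extending [omitted_perm i s] by i -> s i recovers s, and such an extension changes the parity by
    that of i + s i. *)
Lemma odd_omitted_perm k i (s : {perm 'I_k.+1}) :
  odd_perm (omitted_perm i s) = odd i (+) odd (s i) (+) s.
Proof.
suff /(congr1 (@odd_perm _)) : s = lift_perm i (s i) (omitted_perm i s).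
  by rewrite odd_lift_perm => ->; rewrite addbA addbb.
apply/permP=> l; case: (unliftP i l) => [j ->|->]; last by rewrite lift_perm_id.
by rewrite lift_perm_lift permE lift_omitted_index.
Qed.

Lemma permute_upd k (x : {ffun 'I_k.+1 -> T}) i u :
  permute (lift_perm ord_max i 1) (upd x i u) = snoc (omit i x) u.
Proof.
apply: snoc_ext; first by rewrite snoc_max !ffunE lift_perm_id eqxx.
rewrite front_snoc; apply/ffunP=> j; rewrite !ffunE lift_perm_lift perm1.
by rewrite eq_sym (negPf (neq_lift _ _)).
Qed.

End FamilyTheory.

Section FamilyMap.
Variables (T T' T'' : Type).

Lemma fmap_comp k (f : T' -> T'') (h : T -> T') (x : {ffun 'I_k -> T}) :
  fmap f (fmap h x) = fmap (f \o h) x.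
Proof. by apply/ffunP=> i; rewrite !ffunE. Qed.

Variable f : T -> T'.

Lemma eq_fmap k (h : T -> T') (x : {ffun 'I_k -> T}) :
  f =1 h -> fmap f x = fmap h x.
Proof. by move=> fh; apply/ffunP=> i; rewrite !ffunE. Qed.

Lemma fmap_omit k i (x : {ffun 'I_k.+1 -> T}) :
  fmap f (omit i x) = omit i (fmap f x).
Proof. by apply/ffunP=> j; rewrite !ffunE. Qed.

Lemma fmap_front k (x : {ffun 'I_k.+1 -> T}) :
  fmap f (front x) = front (fmap f x).
Proof. exact: fmap_omit. Qed.

Lemma fmap_snoc k (x : {ffun 'I_k -> T}) u :
  fmap f (snoc x u) = snoc (fmap f x) (f u).
Proof.
by apply/ffunP=> i; rewrite !ffunE; case: unlift => // j; rewrite ffunE.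
Qed.

Lemma fmap_upd k (x : {ffun 'I_k -> T}) i u :
  fmap f (upd x i u) = upd (fmap f x) i (f u).
Proof. by apply/ffunP=> j; rewrite !ffunE; case: eqP. Qed.

Lemma fmap_permute k s (x : {ffun 'I_k -> T}) :
  fmap f (permute s x) = permute s (fmap f x).
Proof. by apply/ffunP=> j; rewrite !ffunE. Qed.

End FamilyMap.

Lemma multilinear_snoc (K : fieldType) k (U W : lmodType K)
    (f : {ffun 'I_k.+1 -> U} -> W) (x : {ffun 'I_k -> U}) a u v :
  multilinear f ->
  f (snoc x (a *: u + v)) = a *: f (snoc x u) + f (snoc x v).
(* The 0 is a placeholder, overwritten by the update at [ord_max]. *)
Proof. by move/(_ (snoc x 0) ord_max a u v); rewrite !upd_snoc_max. Qed.

(** * Alternating maps and signs of wedges *)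

Section AlternatingMaps.
Variables (K : fieldType) (k : nat) (U W : lmodType K).
Variable f : {ffun 'I_k -> U} -> W.
Hypotheses (f_lin : multilinear f) (f_alt : alternating f).

Lemma alternating_tperm (x : {ffun 'I_k -> U}) i j :
  i != j -> f (permute (tperm i j) x) = - f x.
Proof.
move=> ij; pose F p q := f (upd (upd x i p) j q).
have F_linl p p' q : F (p + p') q = F p q + F p' q.
  by rewrite /F !(updC _ _ _ ij) -[p]scale1r f_lin !scale1r.
have F_linr p q q' : F p (q + q') = F p q + F p q'.
  by rewrite /F -[q]scale1r f_lin !scale1r.
have F_alt p : F p p = 0.
  by apply: (f_alt ij); rewrite !ffunE !eqxx (negPf ij).
have -> : permute (tperm i j) x = upd (upd x i (x j)) j (x i).
  apply/ffunP=> l; rewrite !ffunE.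
  by case: tpermP => [->|->|/eqP/negPf li /eqP/negPf lj];
    rewrite ?(negPf ij) ?eqxx // li lj.
have -> : f x = F (x i) (x j) by rewrite /F !upd_id.
(* Polarization: expand F (x i + x j) (x i + x j) = 0. *)
apply/eqP; rewrite -addr_eq0 -/(F (x j) (x i)).
have := F_alt (x i + x j); rewrite F_linl !F_linr !F_alt add0r addr0 addrC.
by move->.
Qed.

Lemma alternating_perm (s : {perm 'I_k}) (x : {ffun 'I_k -> U}) :
  f (permute s x) = (-1) ^+ s *: f x.
Proof.
have [ts -> {s}] := prod_tpermP s; elim: ts x => [|[i j] ts IH] x /=.
  by rewrite big_nil odd_perm1 permute1 scale1r.
move=> /andP[ij ts_d]; rewrite big_cons permuteM alternating_tperm //=.
by rewrite IH // odd_permM odd_tperm ij /= -scaleN1r scalerA signrN mulN1r.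
Qed.

End AlternatingMaps.

Lemma wedge_perm (K : fieldType) k (U : lmodType K) s (x : {ffun 'I_k -> U}) :
  wedge (permute s x) = (-1) ^+ s *: wedge x.
Proof.
by apply: alternating_perm; [apply: wedge_multilinear|apply: wedge_alternating].
Qed.

(** The entry at i moves past the k - i entries after it. This puts the right-hand side of axiom
    (iii), where brackets occupy a middle slot, into the shape of the bracket on the direct sum. *)
Lemma wedge_upd (K : fieldType) k (U : lmodType K)
    (x : {ffun 'I_k.+1 -> U}) i u :
  wedge (upd x i u) = (-1) ^+ (k - i) *: wedge (snoc (omit i x) u).
Proof.
rewrite -permute_upd wedge_perm scalerA odd_lift_perm odd_perm1 addbF.
by rewrite -[_ ^+ (k - i)]signr_odd oddB -1?ltnS // -signr_addb addbb scale1r.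
Qed.

(** * Sums over ordered pairs of distinct indices *)

Section PairSums.
Variables (W : nmodType) (k : nat).

Lemma pair_flip_subproof (i : 'I_k.+2) (j : 'I_k.+1) : (unbump j i < k.+1)%N.
Proof. by rewrite /unbump; have := ltn_ord i; have := ltn_ord j; lia. Qed.

(* An ordered pair of distinct indices is coded as (i, lift i j); this is the *)
(* code of the pair (lift i j, i).                                            *)
Definition pair_flip (p : 'I_k.+2 * 'I_k.+1) : 'I_k.+2 * 'I_k.+1 :=
  (lift p.1 p.2, Ordinal (pair_flip_subproof p.1 p.2)).

Lemma lift_pair_flip p : lift (pair_flip p).1 (pair_flip p).2 = p.1.
Proof.
by case: p => i j; apply: val_inj; rewrite /= /bump /unbump; lia.
Qed.

Lemma pair_flipK : involutive pair_flip.
Proof.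
move=> p; rewrite [LHS]surjective_pairing {1}/pair_flip lift_pair_flip /=.
case: p => i j; congr pair; apply: val_inj; rewrite /= /bump /unbump; lia.
Qed.

(** The involution [pair_flip] reindexes the double sum, so the two omitted positions may trade
    roles. *)
Lemma exchange_pairs (F : 'I_k.+2 -> 'I_k.+1 -> W) :
  \sum_i \sum_j F i j =
  \sum_i \sum_j F (pair_flip (i, j)).1 (pair_flip (i, j)).2.
Proof.
rewrite !pair_big /= (reindex_inj (can_inj pair_flipK)).
by apply: eq_bigr => -[].
Qed.

Lemma omit_pair_flip (T : Type) (x : {ffun 'I_k.+2 -> T}) p :
  omit (pair_flip p).2 (omit (pair_flip p).1 x) = omit p.2 (omit p.1 x).
Proof.
case: p => i j; apply/ffunP=> l; rewrite !ffunE; congr (x _).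
by apply: val_inj; rewrite /= [RHS]bumpC.
Qed.

End PairSums.

(** * Multilinearity and multiplicativity of the bracket *)

Section SemidirectProduct.
Variables (K : fieldType) (m : nat) (g : lmodType K).
Variables (br : {ffun 'I_m.+2 -> g} -> g) (alpha beta : {linear g -> g}).
Hypothesis g_nBiHomLie : is_nBiHomLie br alpha beta.
Variables (V : lmodType K) (rho : exterior m.+1 g -> {linear V -> V}).
Variables (alphaV betaV : {linear V -> V}).
Hypothesis V_rep : is_representation br alpha beta rho alphaV betaV.
Hypothesis alphaV_betaV_comm : forall u, alphaV (betaV u) = betaV (alphaV u).
Hypotheses (bij_alpha : bijective alpha) (bij_betaV : bijective betaV).

Local Notation alphaI := (bij_inv bij_alpha).
Local Notation betaVI := (bij_inv bij_betaV).
Local Notation bracket := (br_rho br beta rho alphaV bij_alpha bij_betaV).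
Local Notation alphaD := (dsum_map alpha alphaV).
Local Notation betaD := (dsum_map beta betaV).

Let betaC x : alpha (beta x) = beta (alpha x).
Proof. exact: alpha_beta_comm g_nBiHomLie x. Qed.

Lemma rhoZ a X v : rho (a *: X) v = a *: rho X v.
Proof.
have rho0 : rho 0 v = 0.
  apply: (addrI (rho 0 v)); rewrite addr0.
  by have := rho_linear V_rep 1 0 0 v; rewrite !scale1r addr0 => <-.
by have := rho_linear V_rep a X 0 v; rewrite rho0 !addr0.
Qed.

Lemma alphaI_beta x : alphaI (beta x) = beta (alphaI x).
Proof. by apply: (bij_inj bij_alpha); rewrite betaC !bij_invK. Qed.

Lemma alphaI_linear : linear alphaI.
Proof.
by move=> a x y; apply: (bij_inj bij_alpha); rewrite linearP !bij_invK.
Qed.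

Lemma betaVI_linear : linear betaVI.
Proof.
by move=> a x y; apply: (bij_inj bij_betaV); rewrite linearP !bij_invK.
Qed.

Lemma betaVI_alphaV u : betaVI (alphaV u) = alphaV (betaVI u).
Proof. by apply: (bij_inj bij_betaV); rewrite -alphaV_betaV_comm !bij_invK. Qed.

Lemma fmap_fst_dsum k f h (z : {ffun 'I_k -> g * V}) :
  fmap fst (fmap (dsum_map f h) z) = fmap f (fmap fst z).
Proof. by rewrite !fmap_comp; apply: eq_fmap. Qed.

Lemma bracket_snoc (z : {ffun 'I_m.+1 -> g * V}) w :
  bracket (snoc z w) =
  (br (snoc (fmap fst z) w.1),
   \sum_(i < m.+1) (-1) ^+ (m.+2 - i.+1) *:
     rho (wedge (snoc (omit i (fmap fst z)) (alphaI (beta w.1))))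
         (alphaV (betaVI (z i).2))
   + rho (wedge (fmap fst z)) w.2).
Proof.
rewrite /br_rho !fmap_snoc !front_snoc !snoc_max; congr (_, _ + _).
by apply: eq_bigr => i _; rewrite ffunE.
Qed.

(** In the V-component, each summand sees a given slot either through one wedge entry or through the
    vector acted upon, never both. *)
Lemma bracket_multilinear : multilinear bracket.
Proof.
have rho_upd k (x : {ffun 'I_m.+1 -> g}) c p q v :
    rho (wedge (upd x k (c *: p + q))) v =
    c *: rho (wedge (upd x k p)) v + rho (wedge (upd x k q)) v.
  by rewrite wedge_multilinear (rho_linear V_rep).
have pairP c (p q : g) (u v : V) :
  c *: (p, u) + (q, v) = (c *: p + q, c *: u + v) by [].
move=> z i c p q; rewrite -[z]frontK.
set x := front z; set w := z ord_max.
case: (unliftP ord_max i) => [j ->|->]; last first.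
  rewrite !upd_snoc_max !bracket_snoc pairP; congr pair.
    exact: multilinear_snoc (br_multilinear g_nBiHomLie).
  rewrite [X in _ + X = _]linearP scalerDr addrACA; congr (_ + _).
  rewrite scaler_sumr -big_split; apply: eq_bigr => t _ /=.
  rewrite linearP alphaI_linear
    (multilinear_snoc _ _ _ _ (@wedge_multilinear _ _ _)).
  by rewrite (rho_linear V_rep) scalerDr !scalerA mulrC.
rewrite -!snoc_upd !bracket_snoc pairP !fmap_upd; congr pair.
  by rewrite !snoc_upd (br_multilinear g_nBiHomLie).
rewrite rho_upd scalerDr addrACA; congr (_ + _).
rewrite scaler_sumr -big_split; apply: eq_bigr => t _ /=.
rewrite !scalerA mulrC -!scalerA -scalerDr; congr (_ *: _).
case: (unliftP t j) => [l ->|->].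
  rewrite !omit_upd_lift !snoc_upd rho_upd !ffunE.
  by rewrite (negPf (neq_lift _ _)).
by rewrite !omit_upd !ffunE eqxx /= betaVI_linear !linearP.
Qed.

(** Axiom (i) carries [alphaV] past [rho], and the twists inside the bracket commute with [alpha]
    and [alphaV]. *)
Lemma alpha_bracket z : alphaD (bracket z) = bracket (fmap alphaD z).
Proof.
rewrite -[z]frontK; move: (front z) (z ord_max) => x w.
rewrite fmap_snoc !bracket_snoc /dsum_map /= fmap_fst_dsum; congr pair.
  by rewrite (alpha_br g_nBiHomLie) fmap_snoc.
rewrite linearD linear_sum -(rho_alpha V_rep); congr (_ + _).
apply: eq_bigr => i _; rewrite linearZ -(rho_alpha V_rep) fmap_snoc fmap_omit.
by rewrite ffunE /= betaVI_alphaV bij_invK -betaC bijK.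
Qed.

Lemma beta_bracket z : betaD (bracket z) = bracket (fmap betaD z).
Proof.
rewrite -[z]frontK; move: (front z) (z ord_max) => x w.
rewrite fmap_snoc !bracket_snoc /dsum_map /= fmap_fst_dsum; congr pair.
  by rewrite (beta_br g_nBiHomLie) fmap_snoc.
rewrite linearD linear_sum -(rho_beta V_rep); congr (_ + _).
apply: eq_bigr => i _; rewrite linearZ -(rho_beta V_rep) fmap_snoc fmap_omit.
by rewrite ffunE /= bijK -alphaV_betaV_comm bij_invK [in RHS]alphaI_beta.
Qed.

(** * BiHom-skewsymmetry *)

Definition twisted_action (x : {ffun 'I_m.+2 -> g}) (u : {ffun 'I_m.+2 -> V}) :=
  \sum_(k < m.+2) (-1) ^+ (m.+2 - k.+1) *:
    rho (wedge (fmap beta (omit k x))) (alphaV (u k)).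

Lemma twisted_action_recr x u :
  twisted_action x u =
  \sum_(i < m.+1) (-1) ^+ (m.+2 - i.+1) *:
    rho (wedge (snoc (fmap beta (omit i (front x))) (beta (x ord_max))))
        (alphaV (u (lift ord_max i)))
  + rho (wedge (fmap beta (front x))) (alphaV (u ord_max)).
Proof.
rewrite /twisted_action (bigD1_ord ord_max) //= subnn scale1r addrC.
congr (_ + _); apply: eq_bigr => i _; rewrite -{1}[x]frontK omit_snoc.
by rewrite fmap_snoc /bump leqNgt ltn_ord.
Qed.

(** Since alpha^-1 beta alpha = beta and [betaVI] cancels [betaV], the separate term rho(x)(u_n)
    becomes the summand k = n, with sign +1. *)
Lemma bracket_twisted (z : {ffun 'I_m.+1 -> g * V}) w :
  bracket (snoc (fmap betaD z) (alphaD w)) =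
  (br (snoc (fmap beta (fmap fst z)) (alpha w.1)),
   twisted_action (fmap fst (snoc z w)) (fmap snd (snoc z w))).
Proof.
rewrite bracket_snoc fmap_fst_dsum /=; congr pair.
rewrite twisted_action_recr !fmap_snoc.
rewrite front_snoc !snoc_max; congr (_ + _); apply: eq_bigr => i _.
by rewrite ffunE snoc_lift ffunE /= bijK fmap_omit -betaC bijK.
Qed.

(** As in a cofactor expansion: after reindexing by s, the parity of k + s k from [odd_omitted_perm]
    cancels the change in the alternating sign, leaving the sign of s. *)
Lemma twisted_action_perm s x u :
  twisted_action (permute s x) (permute s u) = (-1) ^+ s *: twisted_action x u.
Proof.
rewrite [in RHS]/twisted_action (reindex_inj (@perm_inj _ s)) scaler_sumr.
apply: eq_bigr => k _; rewrite omit_permute fmap_permute wedge_perm rhoZ.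
rewrite odd_omitted_perm ffunE !scalerA; congr (_ *: _).
rewrite -(signr_odd _ (m.+2 - k.+1)) -(signr_odd _ (m.+2 - (s k).+1)).
by rewrite -!signr_addb !oddB ?ltn_ord //=; congr (_ ^+ _);
  case: (odd m) (odd k) (odd (s k)) (odd_perm s) => [] [] [] [].
Qed.

Lemma twisted_action_swap i j x u :
  i != j -> twisted_action (swap i j x) (swap i j u) = - twisted_action x u.
Proof.
by move=> ij; rewrite !swapE twisted_action_perm odd_tperm ij scaleN1r.
Qed.

Lemma bracket_skew_front (z : {ffun 'I_m.+1 -> g * V}) w (i j : 'I_m.+1) :
  j = i.+1 :> nat ->
  bracket (snoc (fmap betaD (swap i j z)) (alphaD w)) =
  - bracket (snoc (fmap betaD z) (alphaD w)).
Proof.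
move=> ij; rewrite !bracket_twisted; congr pair.
  by rewrite swapE fmap_permute -swapE (br_skew_front g_nBiHomLie).
rewrite swap_snoc swapE !fmap_permute -!swapE twisted_action_swap //.
by rewrite (inj_eq (@lift_inj _ _)) -val_eqE /= ij neq_ltn ltnSn.
Qed.

Lemma bracket_skew_last (z : {ffun 'I_m -> g * V}) w w' :
  bracket (snoc (snoc (fmap betaD z) (betaD w)) (alphaD w')) =
  - bracket (snoc (snoc (fmap betaD z) (betaD w')) (alphaD w)).
Proof.
rewrite -!fmap_snoc !bracket_twisted; congr pair.
  by rewrite !fmap_snoc (br_skew_last g_nBiHomLie).
have -> : snoc (snoc z w) w' =
    swap (lift ord_max ord_max) ord_max (snoc (snoc z w') w).
  apply: snoc_ext; first by rewrite snoc_max ffunE tpermR snoc_lift snoc_max.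
  rewrite front_snoc; apply: snoc_ext; rewrite ?snoc_max ?front_snoc.
    by rewrite !ffunE tpermL unlift_none.
  apply/ffunP=> i; rewrite !ffunE tpermD ?liftK ?snoc_lift //.
    by rewrite (inj_eq (@lift_inj _ _)) neq_lift.
  by rewrite neq_lift.
by rewrite swapE !fmap_permute -!swapE twisted_action_swap // eq_sym neq_lift.
Qed.

(** * The n-BiHom-Jacobi identity *)

(* Axiom (iv) at X = alpha^-1 beta y. *)
Lemma rho_br_twisted (x : {ffun 'I_m -> g}) (y : {ffun 'I_m.+2 -> g}) u :
  rho (wedge (snoc (fmap (beta \o beta) x)
     (alphaI (beta (br (snoc (fmap beta (front y)) (alpha (y ord_max))))))))
    (alphaV (betaV u)) =
  \sum_(k < m.+2) (-1) ^+ (m.+2 - k.+1) *: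
    rho (wedge (fmap (beta \o beta) (omit k y)))
      (rho (wedge (snoc (fmap beta x) (beta (y k)))) (alphaV u)).
Proof.
rewrite -[y]frontK; move: (front y) (y ord_max) => {}y t.
rewrite front_snoc snoc_max.
pose X : {ffun 'I_m.+1 -> g} := fmap (alphaI \o beta) y.
have alphaX : fmap alpha X = fmap beta y.
  by rewrite fmap_comp; apply: eq_fmap => ? /=; rewrite bij_invK.
have betaX : fmap (alpha \o beta) X = fmap (beta \o beta) y.
  by rewrite fmap_comp; apply: eq_fmap => ? /=; rewrite betaC bij_invK.
have -> : alphaI (beta (br (snoc (fmap beta y) (alpha t)))) =
    br (snoc (fmap beta X) (beta t)).
  (* Under the injective [alpha], both sides become [beta^2 y, alpha beta t]. *)
  apply: (bij_inj bij_alpha); rewrite bij_invK (beta_br g_nBiHomLie).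
  rewrite (alpha_br g_nBiHomLie) !fmap_snoc -betaC -alphaX !fmap_comp.
  by congr (br (snoc _ _)); apply: eq_fmap => ? /=; rewrite betaC.
(* In axiom (iv), y_2, ..., y_(n-1) are the entries of beta x and y_1 is beta t; its isolated last
   term is the summand k = n here. *)
rewrite -fmap_comp alphaV_betaV_comm (rho_br V_rep)
  [in RHS](bigD1_ord ord_max) //=.
rewrite subnn scale1r [RHS]addrC snoc_max betaX -/(front _) front_snoc.
congr (_ + _); apply: eq_bigr => i _; rewrite /bump leqNgt ltn_ord add0n.
rewrite omit_snoc fmap_snoc snoc_lift fmap_omit betaX -fmap_omit.
by rewrite ffunE /= bij_invK.
Qed.

(* Axiom (iii) at X = alpha^-1 beta x, Y = beta y. *)
Lemma rho_comm_twisted (x y : {ffun 'I_m.+1 -> g}) u :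
  rho (wedge (fmap (beta \o beta) x)) (rho (wedge (fmap beta y)) (alphaV u)) =
  rho (wedge (fmap (beta \o beta) y)) (rho (wedge (fmap beta x)) (alphaV u))
  + \sum_(j < m.+1) (-1) ^+ (m - j) *:
      rho (wedge (snoc (fmap (beta \o beta) (omit j y))
             (alphaI (beta (br (snoc (fmap beta x) (alpha (y j))))))))
        (alphaV (betaV u)).
Proof.
pose X : {ffun 'I_m.+1 -> g} := fmap (alphaI \o beta) x.
have alphaX : fmap alpha X = fmap beta x.
  by rewrite fmap_comp; apply: eq_fmap => t /=; rewrite bij_invK.
have := rho_comm V_rep X (fmap beta y) (alphaV u).
have -> : fmap (alpha \o beta) X = fmap (beta \o beta) x.
  by rewrite fmap_comp; apply: eq_fmap => t /=; rewrite betaC bij_invK.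
rewrite alphaX -alphaV_betaV_comm => /eqP; rewrite subr_eq addrC fmap_comp.
move=> /eqP ->; congr (_ + _); apply: eq_bigr => j _.
rewrite wedge_upd rhoZ fmap_omit ffunE; congr (_ *: rho (wedge (snoc _ _)) _).
apply: (bij_inj bij_alpha); rewrite bij_invK (beta_br g_nBiHomLie).
rewrite (alpha_br g_nBiHomLie) !fmap_snoc -betaC -alphaX !fmap_comp.
by congr (br (snoc _ _)); apply: eq_fmap => t /=; rewrite betaC.
Qed.

Lemma sum_scaler_pair n (c : 'I_n -> K) (p : 'I_n -> g) (q : 'I_n -> V) :
  \sum_k c k *: (p k, q k) = (\sum_k c k *: p k, \sum_k c k *: q k).
Proof. by apply: (big_rec3 (fun s a b => s = (a, b))) => // k s a b _ ->. Qed.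

Lemma bracket_jacobi (z : {ffun 'I_m.+1 -> g * V})
    (w : {ffun 'I_m.+2 -> g * V}) :
  bracket (snoc (fmap (betaD \o betaD) z)
    (bracket (snoc (fmap betaD (front w)) (alphaD (w ord_max)))))
  = \sum_(k < m.+2) (-1) ^+ (m.+2 - k.+1) *:
      bracket (snoc (fmap (betaD \o betaD) (omit k w))
        (bracket (snoc (fmap betaD z) (alphaD (w k))))).
Proof.
(* The components become opaque variables, so that [ffunE] does not unfold them back into
   projections of z and w. *)
have [x xE] : {x | fmap fst z = x} by exists (fmap fst z).
have [u uE] : {u | fmap snd z = u} by exists (fmap snd z).
have [y yE] : {y | fmap fst w = y} by exists (fmap fst w).
have [v vE] : {v | fmap snd w = v} by exists (fmap snd w).
have zE i : z i = (x i, u i) by rewrite -xE -uE !ffunE -surjective_pairing.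
have wE i : w i = (y i, v i) by rewrite -yE -vE !ffunE -surjective_pairing.
(* Of the two factors [betaV] in an outer argument, [betaVI] absorbs one. *)
have bracketE (t : {ffun 'I_m.+1 -> g * V}) p :
    bracket (snoc (fmap (betaD \o betaD) t) p) =
    (br (snoc (fmap (beta \o beta) (fmap fst t)) p.1),
     \sum_(i < m.+1) (-1) ^+ (m.+2 - i.+1) *:
       rho (wedge (snoc (fmap (beta \o beta) (omit i (fmap fst t)))
              (alphaI (beta p.1))))
           (alphaV (betaV (t i).2))
     + rho (wedge (fmap (beta \o beta) (fmap fst t))) p.2).
  rewrite bracket_snoc -fmap_comp !fmap_fst_dsum fmap_comp.
  congr (_, _ + _); apply: eq_bigr => i _.
  by rewrite [in RHS]fmap_omit !ffunE /= bijK.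
rewrite !bracket_twisted frontK bracketE fmap_front wE xE yE vE.
under [RHS]eq_bigr => k _.
  rewrite bracket_twisted bracketE !fmap_snoc fmap_omit xE yE uE wE /=.
  rewrite twisted_action_recr front_snoc !snoc_max.
  under eq_bigr => i _ do rewrite ffunE wE.
  under [X in rho _ (X + _)]eq_bigr => i _ do rewrite snoc_lift.
  over.
rewrite /= sum_scaler_pair; congr pair; first exact: (br_jacobi g_nBiHomLie).
rewrite /twisted_action [X in _ + X = _]linear_sum.
under [X in _ + X = _]eq_bigr => k _ do
  rewrite linearZ /= rho_comm_twisted scalerDr scaler_sumr.
under [RHS]eq_bigr => k _.
  rewrite [rho _ (_ + _)]linearD !scalerDr /=.
  rewrite [rho _ (\sum_(_ < _) _)]linear_sum !scaler_sumr /=.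
  over.
rewrite !big_split /=.
(* Each side has three groups: the terms in the [u i], the terms where beta x and then beta^2 (y
   without y_k) act on [v k], already identical, and a double sum in the v's. *)
rewrite [RHS]addrCA [X in _ = _ + X]addrC; congr (_ + (_ + _)).
  rewrite exchange_big; apply: eq_bigr => i _ /=.
  rewrite zE rho_br_twisted scaler_sumr; apply: eq_bigr => k _.
  by rewrite [rho _ (_ *: _)]linearZ /= !scalerA mulrC.
(* On the left the outer index selects the v and the inner one the bracketed y; on the right it is
   the reverse. *)
rewrite [RHS]exchange_pairs; apply: eq_bigr => k _; apply: eq_bigr => j _.
rewrite omit_pair_flip lift_pair_flip ffunE /= !scalerA -!exprD.
(* Flipping the pair changes the sum of its two indices by one, which makes up for m - j against m +
   1 - j in the exponents. *)
congr (_ *: _); rewrite -signr_odd -[RHS]signr_odd; congr (_ ^+ _).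
by rewrite /bump /unbump; have := ltn_ord k; have := ltn_ord j; lia.
Qed.


End SemidirectProduct.

Theorem proposition3p3 (K : closedFieldType) (charK0 : [pchar K] =i pred0)
  (m : nat)
  (g : lmodType K) (br : {ffun 'I_m.+2 -> g} -> g)
  (alpha beta : {linear g -> g})
  (g_nBiHomLie : is_nBiHomLie br alpha beta)
  (V : lmodType K) (rho : exterior m.+1 g -> {linear V -> V})
  (alphaV betaV : {linear V -> V})
  (V_rep : is_representation br alpha beta rho alphaV betaV)
  (alphaV_betaV_comm : forall u : V, alphaV (betaV u) = betaV (alphaV u))
  (bij_alpha : bijective alpha) (bij_betaV : bijective betaV) :
  is_nBiHomLie (br_rho br beta rho alphaV bij_alpha bij_betaV)
    (dsum_map alpha alphaV) (dsum_map beta betaV).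
Proof.
split.
- exact: bracket_multilinear.
- move=> z; congr pair; first exact: alpha_beta_comm g_nBiHomLie _.
  exact: alphaV_betaV_comm.
- exact: alpha_bracket.
- exact: beta_bracket.
- exact: bracket_skew_front.
- exact: bracket_skew_last.
- exact: bracket_jacobi.
Qed.
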